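(* Let $n\ge d\ge1$ and $r\ge0$. Let $\mathbb X^r_{d,n-1}$ be the set of all $\psi$-tableaux $X$ of length $r$ such that (x1) $X$ is contained in $\delta_{n-1}$, (x2) row $d$ of $X$ has length $n-d$, and (x3) the prime path of row $d$ of $X$ has height $d$. Let $\mathbb Z^{r+1}_{d,n}$ be the set of all $\psi$-tableaux $Z$ of length $r+1$ such that (z1) $Z$ is contained in $\delta_n$, (z2) rows $d$ and $d+1$ of $Z^{(r)}$ are identical, (z3) the end-box of the $(r+1)$-set of $Z$ is $(d,n-d+1)$, and (z4) the prime path of $(d,n-d+1)$ (i.e. of row $d$ of $Z$) has height $d$. Then: (1) If $X$ is any tableau of length $r$ satisfying (x2) and $Z=\beta_d(\alpha_d(X))$, then each of the first $d$ rows of $Z$ has length one more than the corresponding row of $X$, and each of the first $n-d$ columns of $Z$ has length one more than the corresponding column of $X$. (2) The map $X\mapsto\beta_d(\alpha_d(X))$ is a bijection from $\mathbb X^r_{d,n-1}$ to $\mathbb Z^{r+1}_{d,n}$.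
   Context: Young diagrams use English notation: rows indexed $1,2,\dots$ top to bottom, columns $1,2,\dots$ left to right, $(x,y)$ the box in row $x$, column $y$, row lengths $\lambda_1\ge\lambda_2\ge\cdots$, $\lambda_j=0$ beyond the last row, $\lambda_0=+\infty$. $\delta_m=(m,\dots,1)$ ($m\ge1$), $\delta_m=\emptyset$ ($m\le0$); $[m]=\{1,\dots,m\}$. For $d\ge1$, the height of the prime path of row $d$ of $Y$ is $h_Y(d)=\min\{h\ge1:\lambda_{d-h}\ge\lambda_d+h\}$; the prime path of a box $B$ that is last in its row is the prime path of its row. The $B$-strip is the set of last boxes of rows $x_B-h_Y(x_B)+1,\dots,x_B$, where $x_B$ is the row of $B$; $B$ is a corner box if it is also lowest in its column. $Y'\gtrdot Y$ if $Y'$ is $Y$ with the $B$-strip of some corner box $B$ deleted. A tableau $T$ fills a Young diagram with positive integers, rows strictly increasing left to right, columns weakly increasing downward, label set exactly $[l]$, $l=l(T)$ its length; $r$-set = boxes labelled $r$; $T^{(r)}$ = boxes with labels $\le r$; the end-box of a set of boxes is its box in the row of largest index; two rows are identical if they have the same length and the same labels. A $\psi$-tableau is a tableau with $sh(T^{(r-1)})\gtrdot sh(T^{(r)})$ for all $r\in[l(T)]$. For $d\ge1$ and a tableau $T$, $\alpha_d(T)$ is obtained by moving every row of index $>d$ down one row and placing a copy of row $d$ in row $d+1$. For a tableau $Y$ of length $r$, $\beta_d(Y)$ is obtained by appending a box labelled $r+1$ at the end of each of rows $1,\dots,d$. *)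

(* Defs.v *)
From mathcomp Require Import all_boot.
From mathcomp Require Import boolp classical_sets functions.

Set Implicit Arguments.
Unset Strict Implicit.
Unset Printing Implicit Defensive.

Local Open Scope classical_set_scope.

(* A Young diagram is the sequence of its positive row lengths and a filling is
   the sequence of its nonempty rows, so Leibniz equality is equality of
   diagrams (fillings). Rows and columns are numbered from 1; the accessors
   below return the empty row beyond the last one and are only meant to be
   used at positive indices. *)
Definition box := (nat * nat)%type.

Definition rowlen (Y : seq nat) (i : nat) : nat := nth 0 Y i.-1.

Definition is_young (Y : seq nat) : Prop := sorted geq Y /\ 0 \notin Y.

Definition boxes (Y : seq nat) : set box :=
  [set b | 0 < b.1 /\ 0 < b.2 <= rowlen Y b.1].

Definition staircase (m : nat) : seq nat := rev (iota 1 m).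

(* The disjunct d <= h encodes the convention that row 0 has infinite length:
   for d > 0 the minimum is at most d. *)
Definition height_cond (Y : seq nat) (d h : nat) : bool :=
  (0 < h) && ((d <= h) || (rowlen Y d + h <= rowlen Y (d - h))).

Lemma height_cond_ex (Y : seq nat) (d : nat) : exists h, height_cond Y d h.
Proof. by exists d.+1; rewrite /height_cond leqnSn. Qed.

Definition prime_height (Y : seq nat) (d : nat) : nat :=
  ex_minn (height_cond_ex Y d).

Definition last_box (Y : seq nat) : set box :=
  [set b | boxes Y b /\ b.2 = rowlen Y b.1].

Definition corner_box (Y : seq nat) : set box :=
  [set b | last_box Y b /\ forall x, boxes Y (x, b.2) -> x <= b.1].

Definition strip (Y : seq nat) (B : box) : set box :=
  [set b | last_box Y b /\ (B.1 - prime_height Y B.1).+1 <= b.1 <= B.1].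

(* [covers Y' Y] : the smaller diagram Y' comes first. *)
Definition covers (Y' Y : seq nat) : Prop :=
  exists2 B, corner_box Y B & boxes Y' = boxes Y `\` strip Y B.

Definition filling := seq (seq nat).

Definition row (T : filling) (i : nat) : seq nat := nth [::] T i.-1.

Definition label (T : filling) (b : box) : nat := nth 0 (row T b.1) b.2.-1.

Definition collen (T : filling) (j : nat) : nat :=
  count (fun s : seq nat => j <= size s) T.

Definition tlength (T : filling) : nat := \max_(a <- flatten T) a.

Record is_tableau (T : filling) : Prop := IsTableau {
  tableau_shape : is_young (shape T);
  tableau_rows : forall x y y', boxes (shape T) (x, y) ->
    boxes (shape T) (x, y') -> y < y' -> label T (x, y) < label T (x, y');
  tableau_cols : forall x x' y, boxes (shape T) (x, y) ->
    boxes (shape T) (x', y) -> x < x' -> label T (x, y) <= label T (x', y);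
  tableau_labels : forall a, (a \in flatten T) = (1 <= a <= tlength T) }.

Definition label_set (T : filling) (r : nat) : set box :=
  [set b | boxes (shape T) b /\ label T b = r].

Definition is_end_box (S : set box) (b : box) : Prop :=
  S b /\ forall b', S b' -> b'.1 <= b.1.

(* The filling T^(r). In a tableau the boxes with labels at most r form a prefix
   of each row, and the rows that become empty come last. *)
Definition truncate (r : nat) (T : filling) : filling :=
  [seq s <- [seq [seq a <- t | a <= r] | t <- T] | s != [::]].

Definition psi_tableau (T : filling) : Prop :=
  is_tableau T /\
  forall r, 1 <= r <= tlength T ->
    covers (shape (truncate r.-1 T)) (shape (truncate r T)).

(* If row d is empty then so are all the rows below it and T is unchanged. *)
Definition alpha (d : nat) (T : filling) : filling :=
  if d <= size T then take d T ++ row T d :: drop d T else T.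

Definition beta (d : nat) (T : filling) : filling :=
  [seq if i <= d then rcons (row T i) (tlength T).+1 else row T i
     | i <- iota 1 (maxn d (size T))].

(* The set X^r_{d,n-1}. *)
Definition Xset (r d n : nat) : set filling :=
  [set X | [/\ psi_tableau X, tlength X = r,
     boxes (shape X) `<=` boxes (staircase n.-1),
     size (row X d) = n - d
   & prime_height (shape X) d = d]].

(* The set Z^{r+1}_{d,n}. *)
Definition Zset (r d n : nat) : set filling :=
  [set Z | psi_tableau Z /\
   [/\ tlength Z = r.+1,
     boxes (shape Z) `<=` boxes (staircase n),
     row (truncate r Z) d = row (truncate r Z) d.+1,
     is_end_box (label_set Z r.+1) (d, (n - d).+1)
   & prime_height (shape Z) d = d]].

(* Main.v *)
(* For a diagram with row lengths L put f(j) = L_j + j. The prime path of row c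
   stops at the lowest row t < c with f(t) >= f(c) (or at row 0), so deleting
   the strip lowers f by one on the rows t < j <= c. Say that row d is dominant
   if f(j) < f(d) for all j < d, i.e. if its prime path has height d. A strip
   with t < d <= c and t > 0 would give f(t) >= f(c) >= f(d), so when row d is
   dominant every strip through row d reaches row 1. Hence dominance survives
   the deletion of a strip and, starting from the whole tableau, holds for all
   truncations T^(k). Strips that either reach row 1 or avoid row d correspond
   to each other under duplication of row d, so alpha_d preserves and reflects
   psi-tableaux; beta_d adds the strip of the dominant row d. *)
Require Import Defs.
From mathcomp Require Import all_boot.
From mathcomp Require Import boolp classical_sets functions.
From mathcomp Require Import zify.

Set Implicit Arguments.
Unset Strict Implicit.
Unset Printing Implicit Defensive.

(* Functional form of [covers] with 1-based row lengths: the deleted strip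
   occupies the rows [t < i <= c]; [t = 0] when the prime path leaves through
   row 0. *)
Definition cov (L' L : nat -> nat) : Prop :=
  exists c t, [/\ t < c, L c.+1 < L c, 0 < t -> L c + c <= L t + t,
    forall j, t < j < c -> L j + j < L c + c
    & forall i, 0 < i -> L i = L' i + (t < i <= c)].

Definition dominant (d : nat) (L : nat -> nat) : Prop :=
  forall j, 0 < j < d -> L j + j < L d + d.

(** Effect of [alpha d] on a function of the row index; it serves both for row lengths and for the
    counts [rowcount T k]. *)
Definition dup (d : nat) (L : nat -> nat) (i : nat) : nat :=
  if i <= d then L i else L i.-1.

(** * Strips and duplication of a row *)

(** Index 0 is excluded because the accessors return row 1 there; [cov] reads its arguments at
    positive indices only. *)
Lemma eq_cov (L1' L1 L2' L2 : nat -> nat) :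
  (forall i, 0 < i -> L1' i = L2' i) -> (forall i, 0 < i -> L1 i = L2 i) ->
  cov L1' L1 -> cov L2' L2.
Proof.
move=> e' e [c [t [tc corner top below eqL]]]; exists c, t; split=> //.
- by rewrite -!e //; lia.
- by move=> t0; rewrite -!e ?top //; lia.
- by move=> j jtc; rewrite -!e ?below //; lia.
- by move=> i i0; rewrite -e // -e' // eqL.
Qed.

Lemma strip_across_dominant (d c t : nat) (L : nat -> nat) :
  dominant d L -> t < d <= c -> (0 < t -> L c + c <= L t + t) ->
  (forall j, t < j < c -> L j + j < L c + c) -> t = 0.
Proof.
move=> dom /andP[td dc] top below.
case: (posnP t) => // t0.
have := dom t; have := top t0; have := below d.
by have [<-|] := eqVneq d c; lia.
Qed.

(** If row d lies in the strip, so does every row above it, and all these values of f drop together.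
    Otherwise f(d) stays and the others can only drop. *)
Lemma dominant_cov (d : nat) (L' L : nat -> nat) :
  0 < d -> cov L' L -> dominant d L -> dominant d L'.
Proof.
move=> d0 [c [t [tc _ top below eqL]]] dom j /andP[j0 jd].
have := dom j; have := eqL j j0; have := eqL d d0.
have [dtc|] := boolP (t < d <= c).
  have t0 := strip_across_dominant dom dtc top below.
  by subst t; lia.
lia.
Qed.

Lemma dup_low (d : nat) (L : nat -> nat) (i : nat) : i <= d -> dup d L i = L i.
Proof. by rewrite /dup => ->. Qed.

Lemma dup_high (d : nat) (L : nat -> nat) (i : nat) :
  d <= i -> dup d L i.+1 = L i.
Proof. by rewrite /dup; case: ltnP => //; lia. Qed.

(** A strip ending above row d is unchanged, and one lying below row d moves down by one row. A
    strip through row d starts at row 1 and gains the copy as one more row. *)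
Lemma cov_dup (d : nat) (L' L : nat -> nat) :
  0 < d -> dominant d L -> cov L' L -> cov (dup d L') (dup d L).
Proof.
move=> d0 dom [c [t [tc corner top below eqL]]].
have [cd|dc] := ltnP c d.
  exists c, t; split=> //.
  - by rewrite !dup_low //; lia.
  - by move=> t0; rewrite !dup_low ?top //; lia.
  - by move=> j jtc; rewrite !dup_low ?below //; lia.
  - case=> // i _; have [id|di] := ltnP i d; first by rewrite !dup_low ?eqL.
    by rewrite !dup_high // eqL; lia.
have eqdup t' : t' = (if t < d then t else t.+1) ->
    forall i, 0 < i -> dup d L i = dup d L' i + (t' < i <= c.+1).
  move=> -> [//|i _]; have [id|di] := ltnP i d.
    by rewrite !dup_low // eqL //; case: ifP; lia.
  by rewrite !dup_high // eqL ?(leq_trans d0) //; case: ifP; lia.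
have [td|dt] := ltnP t d.
  have t0 : t = 0 by apply: (strip_across_dominant dom _ top below); rewrite td.
  exists c.+1, 0; split=> //.
  - by rewrite !dup_high //; lia.
  - case=> // j jc; rewrite (dup_high _ dc); have [jd|dj] := ltnP j d.
      rewrite dup_low //.
      (* The strip now ends at row c+1, whose value is f(c) + 1, so f(j+1) <= f(d) <= f(c) gives the
         strict inequality. *)
      have : L j.+1 + j.+1 <= L d + d.
        by have [->|] := eqVneq j.+1 d => //; have := dom j.+1; lia.
      have : L d + d <= L c + c.
        by have [<-|] := eqVneq d c => //; have := below d; lia.
      by lia.
    by rewrite dup_high //; have := below j; lia.
  - by apply: eqdup; rewrite td t0.
exists c.+1, t.+1; split=> //.
- by rewrite !dup_high //; lia.
- by move=> _; rewrite !dup_high //; have := top; lia.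
- case=> // j jc; rewrite !dup_high; try lia.
  by have := below j; lia.
- by apply: eqdup; rewrite ltnNge dt.
Qed.

(** Rows d and d+1 have equal lengths before and after the deletion, so the strip contains both or
    neither. The cases of [cov_dup] can then be read backwards. *)
Lemma cov_of_dup (d : nat) (L' L : nat -> nat) :
  0 < d -> dominant d L -> cov (dup d L') (dup d L) -> cov L' L.
Proof.
move=> d0 dom [c [t [tc corner top below eqL]]].
have eqd := eqL d d0; have eqdS := eqL d.+1 isT.
rewrite !dup_low // in eqd; rewrite !dup_high // in eqdS.
have domdup : dominant d (dup d L).
  by move=> j jd; rewrite !dup_low //; [exact: dom|lia].
have [cd|dc] := ltnP c d.
  exists c, t; split=> //.
  - by rewrite !dup_low in corner; lia.
  - by move=> t0; move: (top t0); rewrite !dup_low //; lia.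
  - by move=> j jtc; move: (below j jtc); rewrite !dup_low //; lia.
  - move=> i i0; have [id|di] := leqP i d.
      by have := eqL i i0; rewrite !dup_low.
    by have := eqL i.+1 isT; rewrite !dup_high; lia.
have {}dc : d < c.
  move: dc; rewrite leq_eqVlt => /orP[/eqP dc|//]; subst c.
  by rewrite dup_high ?dup_low in corner; lia.
case: c tc corner top below eqL eqd eqdS dc =>
  // c tc corner top below eqL eqd eqdS dc.
rewrite !dup_high in corner; try lia.
have eqL' t' : t' = (if t < d then t else t.-1) -> d != t ->
    forall i, 0 < i -> L i = L' i + (t' < i <= c).
  move=> -> dt i i0; have [id|di] := ltnP i d.
    by have := eqL i i0; rewrite !dup_low ?(ltnW id) //; case: ifP; lia.
  by have := eqL i.+1 isT; rewrite !dup_high //; case: ifP; lia.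
(* A strip starting at row d+1 would shorten that row but not its twin, row d. *)
have dt : d != t by lia.
have [td|{}dt'] := ltnP t d.
  have t0 : t = 0.
    by apply: (strip_across_dominant domdup _ top below); rewrite td ltnW.
  exists c, 0; split=> //; try lia.
  - move=> j /andP[j0 jc].
    (* Row d+1 of the duplicate yields f(d) <= f(c) unless d = c; with dominance this settles the
       rows above d. The rows from d on use the inequality shifted by one. *)
    have := below d.+1; have := below j.+1; rewrite !(@dup_high _ _ c); try lia.
    rewrite (@dup_high _ _ d) //.
    have [jd|dj] := ltnP j d; last by rewrite dup_high //; lia.
    have := dom j.
    by have [->|] := eqVneq d c; lia.
  - by apply: eqL' => //; rewrite td t0.
case: t tc top below eqL eqd eqdS eqL' dt dt' =>
  [|t] tc top below eqL eqd eqdS eqL' dt dt'; first lia.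
exists c, t; split=> //; try lia.
- by move=> t0; have := top isT; rewrite !dup_high; lia.
- by move=> j jtc; have := below j.+1; rewrite !dup_high; lia.
- by apply: eqL' => //; rewrite ltnNge dt'.
Qed.

(** * The covering relation on diagrams *)

(** With t = c - h, the inequality in [height_cond] says f(t) >= f(c). Minimality of h makes t the
    largest such index below c, or 0 if there is none. *)
Lemma prime_height_spec (Y : seq nat) (c : nat) : 0 < c ->
  [/\ 0 < prime_height Y c <= c,
      0 < c - prime_height Y c ->
      rowlen Y c + c <= rowlen Y (c - prime_height Y c) + (c - prime_height Y c)
    & forall j, c - prime_height Y c < j < c ->
      rowlen Y j + j < rowlen Y c + c].
Proof.
move=> c0; rewrite /prime_height; case: ex_minnP => h hh hmin.
have hc : h <= c by apply: hmin; rewrite /height_cond c0 leqnn.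
move: hh => /andP[h0 hh]; split.
- by rewrite h0.
- by move: hh => /orP[|]; lia.
- move=> j jc; rewrite ltnNge; apply/negP => fj.
  have := hmin (c - j); rewrite /height_cond subKn; lia.
Qed.

Lemma prime_height_eq (Y : seq nat) (c t : nat) : t < c ->
  (0 < t -> rowlen Y c + c <= rowlen Y t + t) ->
  (forall j, t < j < c -> rowlen Y j + j < rowlen Y c + c) ->
  prime_height Y c = c - t.
Proof.
move=> tc top below.
have [hc toph belowh] := prime_height_spec Y (leq_ltn_trans (leq0n t) tc).
have [|tlt|] := ltngtP (c - prime_height Y c) t; last lia.
  by move=> ht; have := belowh t; have := top; lia.
by have := below (c - prime_height Y c); have := toph; lia.
Qed.

Lemma prime_height_dominant (Y : seq nat) (d : nat) : 0 < d ->
  prime_height Y d = d <-> dominant d (rowlen Y).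
Proof.
move=> d0; split=> [eqd|dom].
  have [_ _] := prime_height_spec Y d0.
  by rewrite eqd subnn.
by rewrite -[RHS]subn0; apply: prime_height_eq.
Qed.

Lemma nonincr_le (L : nat -> nat) : (forall i, 0 < i -> L i.+1 <= L i) ->
  forall i j, 0 < i <= j -> L j <= L i.
Proof.
move=> dec i j /andP[i0]; elim: j => [|j IH]; first by case: i i0.
rewrite leq_eqVlt ltnS => /orP[/eqP->//|ij].
by apply: leq_trans (IH ij); apply: dec; lia.
Qed.

Lemma covers_cov (Y' Y : seq nat) :
  (forall i, 0 < i -> rowlen Y i.+1 <= rowlen Y i) ->
  covers Y' Y <-> cov (rowlen Y') (rowlen Y).
Proof.
move=> dec; have anti := nonincr_le dec; split.
  case=> -[c y] [[[/= c0 y0] ly] corner] eqY; simpl in *; subst y.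
  have [hc top below] := prime_height_spec Y c0.
  (* The equality of box sets, read at the box (i, y). *)
  have cut i y : 0 < i -> 0 < y -> (y <= rowlen Y' i) =
      (y <= rowlen Y i) &&
      ~~ ((y == rowlen Y i) && (c - prime_height Y c < i <= c)).
    move=> i0 yp; apply/idP/idP.
      move=> yY'; have : boxes Y' (i, y) by rewrite /boxes /= yp.
      rewrite eqY => -[[_ /= /andP[_ yY]] nstrip]; rewrite yY /=.
      apply/negP => /andP[/eqP yL inc]; apply: nstrip.
      by do !split=> //=; rewrite yp.
    move=> /andP[yY nin].
    have : boxes Y' (i, y).
      rewrite eqY; split; first by rewrite /boxes /= yp.
      move=> -[[_ /= yL] inc]; move/negP: nin; apply.
      by rewrite yL eqxx.
    by case=> _ /= /andP[].
  exists c, (c - prime_height Y c); split=> //; first lia.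
    rewrite ltnNge; apply/negP => cS.
    have : c.+1 <= c by apply: corner; split=> //=; lia.
    by rewrite ltnn.
  (* Rows down to c are at least as long as row c, hence nonempty, so losing a box really shortens
     them by one. *)
  move=> i i0; have Li : i <= c -> 0 < rowlen Y i.
    by move=> ic; have := anti i c; lia.
  (* Boxes at and next to the row ends in the two diagrams suffice to compare the two lengths. *)
  have cut1 := @cut i (rowlen Y' i) i0.
  have cut2 := @cut i (rowlen Y i) i0.
  have cut3 := @cut i (rowlen Y' i).+1 i0.
  have cut4 := @cut i (rowlen Y i).-1 i0.
  by case: (boolP (_ < i <= c)) cut1 cut2 cut3 cut4 => /= inc; lia.
move=> [c [t [tc corner top below eqL]]].
have c0 : 0 < c by lia.
have ph := prime_height_eq tc top below.
exists (c, rowlen Y c).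
  split; first by split=> //; split=> //=; lia.
  move=> x [/= x0 /andP[_ xc]]; rewrite leqNgt; apply/negP => cx.
  by have := anti c.+1 x; lia.
apply/seteqP; split=> -[i y] /=;
  rewrite /strip /last_box /boxes /= ph subKn ?(ltnW tc) //.
  move=> [i0 yY']; have := eqL i i0 => eqi; split; first by split=> //; lia.
  by move=> [[_ yL] inc]; move: eqi; rewrite inc; lia.
move=> [[i0 yY] nstrip]; split=> //; have eqi := eqL i i0.
have [yL|] := eqVneq y (rowlen Y i); last by case: (t < i <= c) eqi; lia.
have [inc|] := boolP (t < i <= c); first by case: nstrip; do !split=> //; lia.
by move=> /negbTE ninc; move: eqi; rewrite ninc; lia.
Qed.

(** * Tableaux through row counts *)

(** In a tableau this is the length of row i of T^(k), see [rowlen_truncate]. *)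
Definition rowcount (T : filling) (k i : nat) : nat :=
  count (fun a => a <= k) (row T i).

(** Without empty rows, the first index at which [row] returns the empty row reveals the number of
    rows. *)
Lemma row_ext (T U : filling) : [::] \notin T -> [::] \notin U ->
  (forall i, 0 < i -> row T i = row U i) -> T = U.
Proof.
move=> T0 U0 eqTU; have rowS i : nth [::] T i = nth [::] U i.
  exact: (eqTU i.+1).
apply: (@eq_from_nth _ [::]) => [|i _]; last exact: rowS.
apply/eqP; rewrite eqn_leq; apply/andP; split; rewrite leqNgt; apply/negP => h.
  by move: T0; rewrite -(nth_default [::] (leqnn (size U))) -rowS mem_nth.
by move: U0; rewrite -(nth_default [::] (leqnn (size T))) rowS mem_nth.
Qed.

Lemma mem_flatten_row (T : filling) (a : nat) :
  a \in flatten T <-> exists2 i, 0 < i & a \in row T i.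
Proof.
split=> [/flattenP[s /(nthP [::])[i _ <-] ai]|[i i0 ai]]; first by exists i.+1.
apply/flattenP; exists (row T i) => //; rewrite mem_nth // ltnNge.
apply/negP => h.
by move: ai; rewrite /row nth_default.
Qed.

Lemma tlength_max (T : filling) (i a : nat) :
  0 < i -> a \in row T i -> a <= tlength T.
Proof.
move=> i0 ai; rewrite /tlength; apply: leq_bigmax_seq => //.
by apply/mem_flatten_row; exists i.
Qed.

Lemma tlength_eq (T : filling) (m : nat) :
  (forall a, (a \in flatten T) = (1 <= a <= m)) -> tlength T = m.
Proof.
move=> eqT; apply/eqP; rewrite eqn_leq; apply/andP; split.
  by apply/bigmax_leqP_seq => a; rewrite eqT => /andP[].
by case: m eqT => // m eqT; apply: leq_bigmax_seq => //; rewrite eqT leqnn.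
Qed.

Lemma rowlen_shape (T : filling) (i : nat) :
  rowlen (shape T) i = size (row T i).
Proof.
rewrite /rowlen /row; have [h|h] := ltnP i.-1 (size T); first exact: nth_map.
by rewrite !nth_default ?size_map.
Qed.

Lemma rowcount_size (T : filling) (k i : nat) : 0 < i -> tlength T <= k ->
  rowcount T k i = size (row T i).
Proof.
move=> i0 Tk; apply/eqP; rewrite -all_count; apply/allP => a ai.
exact: leq_trans (tlength_max i0 ai) Tk.
Qed.

(** The labels at most [k] form a prefix of an increasing row. This turns conditions on counts into
    conditions on entries. *)
Lemma lt_count_sorted (s : seq nat) (k j : nat) : sorted ltn s ->
  (j < count (fun a => a <= k) s) = (j < size s) && (nth 0 s j <= k).
Proof.
elim: s j => // a s IH j /= as_; have /IH{}IH := path_sorted as_.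
have [ak|ka] := leqP a k; first by case: j => //= j; rewrite !ltnS -IH.
have gt_k : {in a :: s, forall b, k < b}.
  move=> b; rewrite inE => /orP[/eqP->//|bs].
  have /allP/(_ b bs) := order_path_min ltn_trans as_.
  exact: ltn_trans.
rewrite add0n -[count _ s]add0n; have := gt_k (nth 0 (a :: s) j).
have -> : count (fun b => b <= k) s = 0.
  apply/eqP; rewrite -leqn0 leqNgt -has_count; apply/hasPn => b bs.
  by rewrite -ltnNge gt_k // inE bs orbT.
rewrite addn0 ltn0; have [js|//] := ltnP j (size s).+1.
by move=> /(_ (@mem_nth _ 0 (a :: s) j js)); rewrite ltnNge => /negbTE->.
Qed.

(* For strictly increasing rows, the shape and column conditions together say
   that the number of labels at most [k] is nonincreasing in the row index. *)
Record tableau_rows_spec (T : filling) : Prop := TableauRowsSpec {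
  rows_nonempty : [::] \notin T;
  rows_sorted : forall i, 0 < i -> sorted ltn (row T i);
  rowcount_noninc : forall k i, 0 < i -> rowcount T k i.+1 <= rowcount T k i;
  rows_labels : forall a, (a \in flatten T) = (1 <= a <= tlength T) }.

Lemma tableauE (T : filling) : is_tableau T <-> tableau_rows_spec T.
Proof.
split=> [[[sorted_T pos_T] rows_T cols_T labels_T]|
  [ne_T rows_T cnt_T labels_T]].
  have ne_T : [::] \notin T.
    by apply: contra pos_T => T0; apply/mapP; exists [::].
  have srt i : 0 < i -> sorted ltn (row T i).
    move=> i0; apply/(sortedP 0) => j js; have := rows_T i j.+1 j.+2.
    by apply; rewrite /boxes /= ?rowlen_shape; lia.
  split=> // k i i0; rewrite leqNgt; apply/negP => lt_cnt.
  (* With p = [rowcount T k i], column p + 1 holds a label at most k in row i+1 but a larger one in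
     row i, against the column condition. *)
  have := lt_count_sorted k (rowcount T k i) (srt i.+1 isT).
  rewrite lt_cnt => /esym/andP[jS lek].
  have le_size : size (row T i.+1) <= size (row T i).
    rewrite -!rowlen_shape /rowlen; case: i i0 {lt_cnt lek jS} => // i _ /=.
    have [h|h] := ltnP i.+1 (size (shape T)); last by rewrite nth_default.
    exact: (sortedP 0 sorted_T).
  have := lt_count_sorted k (rowcount T k i) (srt i i0).
  rewrite ltnn (leq_trans jS le_size) => /esym/negbT/negP; apply.
  apply: leq_trans lek; have := cols_T i i.+1 (rowcount T k i).+1.
  by apply; rewrite /boxes /= ?rowlen_shape; lia.
have anti k := nonincr_le (cnt_T k).
split=> //.
- split.
    apply/(sortedP 0) => i _.
    rewrite -/(rowlen (shape T) i.+2) -/(rowlen (shape T) i.+1) !rowlen_shape.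
    by rewrite /geq /= -!(rowcount_size _ (leqnn _)) // cnt_T.
  by apply: contra ne_T => /mapP[s sT /esym/eqP]; rewrite size_eq0 => /eqP <-.
- move=> x y y' [/= x0 /andP[y0 _]] [_ /= /andP[y'0]].
  rewrite rowlen_shape => y'x lt_yy'.
  have y'lt : y'.-1 < size (row T x) by lia.
  have ylt : y.-1 < size (row T x) by apply: leq_ltn_trans y'lt; lia.
  by apply: (sorted_ltn_nth ltn_trans 0 (rows_T x x0) _ _ ylt y'lt); lia.
- move=> x x' y [/= x0 _] [/= x'0 /andP[y0]].
  rewrite rowlen_shape => yx' lt_xx'.
  (* For this k, row x' has at least y labels up to k, hence so does row x. *)
  set k := label T (x', y); have : y.-1 < rowcount T k x.
    apply: leq_trans (anti k x x' _); last by rewrite x0 ltnW.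
    by rewrite lt_count_sorted ?rows_T // prednK // yx' leqnn.
  by rewrite lt_count_sorted ?rows_T // => /andP[].
Qed.

(** Empty rows form a suffix when sizes do not increase, so removing them shifts no other row and
    the default value replaces them. *)
Lemma row_filter_nonempty (U : filling) (i : nat) :
  (forall j, size (nth [::] U j.+1) <= size (nth [::] U j)) ->
  nth [::] [seq s <- U | s != [::]] i = nth [::] U i.
Proof.
elim: U i => // s U IH i dec; have decU j := dec j.+1.
have [s0|s0] := eqVneq s [::]; last first.
  by rewrite /= s0; case: i => //= i; exact: IH.
have U0 j : nth [::] U j = [::].
  apply/nilP; elim: j => [|j IHj]; rewrite /nilp -leqn0.
    by have := dec 0; rewrite /= s0.
  by apply: leq_trans (decU j) _; rewrite leqn0.
by rewrite /= s0 /= IH //; case: i => [|i] /=; rewrite !U0.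
Qed.

Lemma row_truncate (T : filling) (k i : nat) : is_tableau T -> 0 < i ->
  row (truncate k T) i = [seq a <- row T i | a <= k].
Proof.
move=> /tableauE[_ _ dec _] i0; have nth_trunc j :
    nth [::] [seq [seq a <- t | a <= k] | t <- T] j =
    [seq a <- row T j.+1 | a <= k].
  have [h|h] := ltnP j (size T); first by rewrite (nth_map [::]).
  by rewrite /row !nth_default ?size_map.
rewrite /row /truncate row_filter_nonempty => [|j].
  by rewrite nth_trunc prednK.
by rewrite !nth_trunc !size_filter; apply: dec.
Qed.

Lemma rowlen_truncate (T : filling) (k i : nat) : is_tableau T -> 0 < i ->
  rowlen (shape (truncate k T)) i = rowcount T k i.
Proof. by move=> tT i0; rewrite rowlen_shape row_truncate // size_filter. Qed.

Lemma psi_tableauE (T : filling) : psi_tableau T <-> is_tableau T /\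
  forall k, 1 <= k <= tlength T -> cov (rowcount T k.-1) (rowcount T k).
Proof.
split=> -[tT psiT]; split=> // k kT.
  apply: (eq_cov _ _ (iffLR (covers_cov _ _) (psiT k kT))) => i i0;
    rewrite !rowlen_truncate //.
  by case/tableauE: tT => _ _ + _; apply.
apply/covers_cov => [i i0|]; first rewrite !rowlen_truncate //.
  by case/tableauE: tT => _ _ + _; apply.
by apply: eq_cov (psiT k kT) => i i0; rewrite !rowlen_truncate.
Qed.

Lemma dominant_truncation (T : filling) (d k : nat) : 0 < d -> psi_tableau T ->
  dominant d (rowlen (shape T)) -> k <= tlength T -> dominant d (rowcount T k).
Proof.
move=> d0 /psi_tableauE[tT covT] domT kT.
(* Induction on the number of largest labels removed from the whole tableau. *)
rewrite -(subKn kT); elim: (_ - k) (leq_subr k (tlength T)) => [_|m IH mT].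
  move=> j jd; rewrite subn0 !rowcount_size -?rowlen_shape //; last by lia.
  exact: domT.
apply: (dominant_cov d0 _ (IH (ltnW mT))); rewrite subnS; apply: covT; lia.
Qed.

(** * The maps alpha and beta *)

Lemma row_alpha (d : nat) (T : filling) (i : nat) : 0 < d -> 0 < i ->
  row (alpha d T) i = if i <= d then row T i else row T i.-1.
Proof.
case: i => // i d0 _; rewrite /alpha /row /=.
have [dT|Td] := leqP d (size T); last first.
  by case: ltnP => // di; rewrite !nth_default //; lia.
rewrite nth_cat size_takel //; case: ltnP => [id|di]; first by rewrite nth_take.
have [->|ne] := eqVneq i d; first by rewrite subnn.
rewrite -(@prednK (i - d)) /=; last lia.
by rewrite nth_drop; congr nth; lia.
Qed.

Lemma alpha_nonempty (d : nat) (T : filling) : 0 < d -> [::] \notin T ->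
  [::] \notin alpha d T.
Proof.
move=> d0 T0; rewrite /alpha; case: ifP => // dT.
rewrite mem_cat inE !negb_or; apply/and3P; split.
- by apply: contra T0; apply: mem_take.
- by apply: contra T0 => /eqP->; rewrite mem_nth // prednK.
- by apply: contra T0; apply: mem_drop.
Qed.

Lemma mem_flatten_alpha (d : nat) (T : filling) : 0 < d ->
  flatten (alpha d T) =i flatten T.
Proof.
move=> d0 a; apply/idP/idP => /mem_flatten_row[i i0 ai]; apply/mem_flatten_row.
  move: ai; rewrite row_alpha //; case: leqP => di ai; first by exists i.
  by exists i.-1 => //; lia.
have [id|di] := leqP i d; first by exists i; rewrite // row_alpha // id.
by exists i.+1; rewrite // row_alpha // ltnNge (ltnW di).
Qed.

Lemma tlength_alpha (d : nat) (T : filling) : 0 < d ->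
  tlength (alpha d T) = tlength T.
Proof.
(* The maximum is idempotent, so the repeated labels of row d do not change it. *)
move=> d0; apply: eq_big_idem => //; first exact: maxnn.
exact: mem_flatten_alpha.
Qed.

Lemma rowcount_alpha (d : nat) (T : filling) (k i : nat) : 0 < d -> 0 < i ->
  rowcount (alpha d T) k i = dup d (rowcount T k) i.
Proof. by move=> d0 i0; rewrite /rowcount row_alpha // /dup; case: ifP. Qed.

Lemma row_beta (d : nat) (T : filling) (i : nat) : 0 < i ->
  row (beta d T) i =
    if i <= d then rcons (row T i) (tlength T).+1 else row T i.
Proof.
case: i => // i _; rewrite {1}/row /beta /=.
have [h|h] := ltnP i (maxn d (size T)).
  by rewrite (nth_map 0) ?size_iota // nth_iota.
rewrite nth_default ?size_map ?size_iota //.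
by rewrite ltnNge (leq_trans _ h) ?leq_maxl //= /row nth_default //; lia.
Qed.

Lemma beta_nonempty (d : nat) (T : filling) : [::] \notin T ->
  [::] \notin beta d T.
Proof.
move=> T0; apply/mapP => -[i]; rewrite mem_iota => /andP[i0 im].
case: leqP => [_|di ri]; first by case: (row T i).
have iT : i.-1 < size T by lia.
by move: T0; rewrite ri /row mem_nth.
Qed.

Lemma rowcount_beta (d : nat) (T : filling) (k i : nat) : 0 < i ->
  rowcount (beta d T) k i = rowcount T k i + (i <= d) * (tlength T < k).
Proof.
move=> i0; rewrite /rowcount row_beta //; case: ifP => _; last by rewrite addn0.
by rewrite -cats1 count_cat /= addn0 mul1n.
Qed.

Lemma alpha_tableau (d : nat) (T : filling) : 0 < d -> is_tableau T ->
  is_tableau (alpha d T).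
Proof.
move=> d0 /tableauE[ne_T srt_T dec_T lab_T]; apply/tableauE; split.
- exact: alpha_nonempty.
- by move=> i i0; rewrite row_alpha //; case: leqP => di; apply: srt_T; lia.
- move=> k i i0; rewrite !rowcount_alpha //; have [id|di] := leqP d i.
    have [<-|ne] := eqVneq d i; first by rewrite dup_high // dup_low.
    by case: i i0 id ne => // i _ id ne; rewrite !dup_high ?dec_T //; lia.
  by rewrite !dup_low ?dec_T // ltnW.
- by move=> a; rewrite mem_flatten_alpha // tlength_alpha.
Qed.

Lemma mem_flatten_beta (d : nat) (T : filling) (a : nat) : 0 < d ->
  (a \in flatten (beta d T)) = (a == (tlength T).+1) || (a \in flatten T).
Proof.
move=> d0; apply/idP/idP.
  move=> /mem_flatten_row[i i0]; rewrite row_beta //; have [id|di] := leqP i d.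
    rewrite mem_rcons inE => /orP[->//|ai]; apply/orP; right.
    by apply/mem_flatten_row; exists i.
  by move=> ai; apply/orP; right; apply/mem_flatten_row; exists i.
move=> /orP[/eqP->|/mem_flatten_row[i i0 ai]]; apply/mem_flatten_row.
  by exists d; rewrite // row_beta // leqnn mem_rcons mem_head.
exists i => //; rewrite row_beta //; case: ifP => // _.
by rewrite mem_rcons inE ai orbT.
Qed.

Lemma labels_beta (d : nat) (T : filling) (a : nat) : 0 < d -> is_tableau T ->
  (a \in flatten (beta d T)) = (1 <= a <= (tlength T).+1).
Proof. by move=> d0 tT; rewrite mem_flatten_beta // tableau_labels //; lia. Qed.

Lemma tlength_beta (d : nat) (T : filling) : 0 < d -> is_tableau T ->
  tlength (beta d T) = (tlength T).+1.
Proof. by move=> d0 tT; apply: tlength_eq => a; apply: labels_beta. Qed.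

Lemma beta_tableau (d : nat) (T : filling) : 0 < d -> is_tableau T ->
  is_tableau (beta d T).
Proof.
move=> d0 tT; have /tableauE[ne_T srt_T dec_T lab_T] := tT.
apply/tableauE; split.
- exact: beta_nonempty.
- move=> i i0; rewrite row_beta //; case: ifP => _; last exact: srt_T.
  have := srt_T i i0; case E: (row T i) => [|b s] //= ss.
  rewrite rcons_path ss /= ltnS; apply: (tlength_max i0).
  by rewrite E mem_last.
- move=> k i i0; rewrite !rowcount_beta // leq_add // ?dec_T //.
  by rewrite leq_mul2r; apply/orP; right; case: (leqP i.+1 d) => // /ltnW->.
- by move=> a; rewrite labels_beta // tlength_beta.
Qed.

Lemma beta_alpha_rows (d : nat) (X : filling) (i : nat) : 0 < d -> 0 < i ->
  row (beta d (alpha d X)) i =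
    if i <= d then rcons (row X i) (tlength X).+1 else row X i.-1.
Proof.
move=> d0 i0; rewrite row_beta // row_alpha // tlength_alpha //.
by case: (i <= d).
Qed.

(** Row i of X is row i of the image without its last label if i <= d, and row i+1 of the image if i
    > d. *)
Lemma beta_alpha_inj (d : nat) (X X' : filling) : 0 < d ->
  [::] \notin X -> [::] \notin X' -> tlength X = tlength X' ->
  beta d (alpha d X) = beta d (alpha d X') -> X = X'.
Proof.
move=> d0 ne ne' eql eqb; apply: row_ext => // i i0.
have [id|di] := leqP i d.
  have := congr1 (row^~ i) eqb; rewrite /=.
  by rewrite !beta_alpha_rows // id eql => /rcons_inj[].
have := congr1 (row^~ i.+1) eqb; rewrite /=.
by rewrite !beta_alpha_rows // ltnNge (ltnW di).
Qed.

Lemma rowlen_staircase (m i : nat) : 0 < i -> rowlen (staircase m) i = m.+1 - i.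
Proof.
case: i => // i _; rewrite /rowlen /staircase /=.
have [im|mi] := ltnP i m; last by rewrite nth_default ?size_rev ?size_iota; lia.
by rewrite nth_rev ?size_iota // nth_iota; lia.
Qed.

Lemma sub_boxes (Y Y' : seq nat) : (boxes Y `<=` boxes Y')%classic <->
  forall i, 0 < i -> rowlen Y i <= rowlen Y' i.
Proof.
split=> [sub i i0|le -[i y] [/= i0 /andP[y0 yY]]].
  case: (posnP (rowlen Y i)) => [->//|L0].
  have /sub[_ /= /andP[]] : boxes Y (i, rowlen Y i).
    by split=> //=; rewrite L0 leqnn.
  by [].
by split=> //=; rewrite y0 (leq_trans yY) // le.
Qed.

(** * The bijection *)

Lemma beta_alpha_sizes (d : nat) (X : filling) (i : nat) :
  0 < d -> 0 < i <= d ->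
  size (row (beta d (alpha d X)) i) = (size (row X i)).+1.
Proof. by move=> d0 /andP[i0 id]; rewrite beta_alpha_rows // id size_rcons. Qed.

(** Form suited to counting rows that reach a given column: the copy of row d is the only added
    row. *)
Lemma beta_alpha_cat (d : nat) (X : filling) :
  0 < d <= size X -> [::] \notin X ->
  beta d (alpha d X) =
    [seq rcons s (tlength X).+1 | s <- take d X] ++ row X d :: drop d X.
Proof.
move=> /andP[d0 dX] X0; apply: row_ext.
- exact/beta_nonempty/alpha_nonempty.
- rewrite mem_cat inE !negb_or; apply/and3P; split.
  + by apply/mapP => -[[]].
  + by apply: contra X0 => /eqP->; rewrite mem_nth // prednK.
  + by apply: contra X0; apply: mem_drop.
case=> // i _.
rewrite beta_alpha_rows // /row /= nth_cat size_map size_takel //.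
have [id|di] := ltnP i d.
  by rewrite (nth_map [::]) ?size_takel // nth_take.
have [->|ne] := eqVneq i d; first by rewrite subnn.
rewrite -(@prednK (i - d)) /=; last lia.
by rewrite nth_drop; congr nth; lia.
Qed.

(** Rows 1 to d already reach column j because row d does, so the appended boxes lie to its right;
    only the copy of row d adds a box. *)
Lemma beta_alpha_collen (d : nat) (X : filling) (j : nat) : 0 < d ->
  is_tableau X -> 0 < j <= size (row X d) ->
  collen (beta d (alpha d X)) j = (collen X j).+1.
Proof.
move=> d0 /tableauE[ne _ dec _] /andP[j0 jd].
have dX : d <= size X.
  rewrite leqNgt; apply/negP => Xd; move: jd; rewrite /row nth_default /=.
    by rewrite leqNgt j0.
  by rewrite -ltnS prednK.
have long : {in take d X, forall s, j <= size s}.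
  move=> _ /(nthP [::])[i + <-]; rewrite size_takel // => id.
  rewrite nth_take //; apply: leq_trans jd _.
  rewrite -[nth _ _ _]/(row X i.+1) -!(rowcount_size _ (leqnn _)) //.
  exact: (nonincr_le (dec _)).
rewrite beta_alpha_cat ?d0 // /collen -[X in (count _ X).+1](cat_take_drop d).
rewrite !count_cat /= jd add1n addnS count_map; congr (_ + _).+1.
by apply: eq_in_count => s /long js /=; rewrite js size_rcons leqW.
Qed.

Lemma beta_alpha_Zset (n d r : nat) (X : filling) : 0 < d <= n ->
  Xset r d n X -> Zset r d n (beta d (alpha d X)).
Proof.
move=> /andP[d0 dn] [psiX lX inX sizeX /(prime_height_dominant _ d0) domX].
have [tX covX] := iffLR (psi_tableauE _) psiX.
have tY := alpha_tableau d0 tX; have tZ := beta_tableau d0 tY.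
have lY : tlength (alpha d X) = r by rewrite tlength_alpha.
have lZ : tlength (beta d (alpha d X)) = r.+1 by rewrite tlength_beta ?lY.
have rowZ i : 0 < i -> row (beta d (alpha d X)) i =
    if i <= d then rcons (row X i) r.+1 else row X i.-1.
  by move=> i0; rewrite beta_alpha_rows // lX.
have cntZ k i : 0 < i -> k <= r ->
    rowcount (beta d (alpha d X)) k i = dup d (rowcount X k) i.
  move=> i0 kr; rewrite rowcount_beta // rowcount_alpha // lY [r < k]ltnNge kr.
  by rewrite muln0 addn0.
have cntZ_last i : 0 < i -> rowcount (beta d (alpha d X)) r.+1 i =
    dup d (fun i => size (row X i)) i + (i <= d).
  move=> i0; rewrite rowcount_beta // rowcount_alpha // lY ltnSn muln1.
  by rewrite /dup; case: leqP => di; rewrite rowcount_size ?lX //; lia.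
have sizeZ i : 0 < i -> size (row (beta d (alpha d X)) i) =
    dup d (fun i => size (row X i)) i + (i <= d).
  by move=> i0; rewrite -cntZ_last // rowcount_size ?lZ.
(* The staircase bound L_i <= n - i uses truncated subtraction; the maximum covers the rows beyond
   the staircase. *)
have boxX i : 0 < i -> size (row X i) + i <= maxn n i.
  move=> i0; have /sub_boxes/(_ i i0) := inX.
  by rewrite rowlen_shape rowlen_staircase //; lia.
have domX' j : 0 < j < d -> size (row X j) + j < size (row X d) + d.
  by move=> jd; have := domX j jd; rewrite !rowlen_shape.
split; last split=> //.
- apply/psi_tableauE; split=> // k; rewrite lZ => /andP[k0].
  rewrite leq_eqVlt => /orP[/eqP->|kr] /=.
    (* The last strip is rows 1 to d: row d+1 is the copy without the new box, so row d ends in a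
       corner, and dominance leads the path to row 0. *)
    exists d, 0; split=> //.
    + by rewrite !cntZ_last // dup_high // dup_low // leqnn ltnn; lia.
    + move=> j jd; rewrite !cntZ_last; try lia.
      by rewrite !dup_low; try lia; have := domX' j jd; lia.
    + move=> i i0; rewrite cntZ_last // cntZ // i0; congr (_ + _).
      by rewrite /dup; case: leqP => di; rewrite rowcount_size ?lX //; lia.
  apply: (@eq_cov (dup d (rowcount X k.-1)) (dup d (rowcount X k))).
  + by move=> i i0; rewrite cntZ //; lia.
  + by move=> i i0; rewrite cntZ.
  apply: cov_dup => //; first by apply: dominant_truncation => //; rewrite lX.
  by apply: covX; rewrite lX k0.
- apply/sub_boxes => i i0; rewrite rowlen_shape rowlen_staircase // sizeZ //.
  (* For i < d dominance gives f(i) < f(d) = n, leaving room for the new box. Rows below d move down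
     by one, as does the staircase bound. *)
  have [id|di] := leqP i d.
    rewrite dup_low //; have [->|ne] := eqVneq i d; first lia.
    by have := domX' i; lia.
  by case: i i0 di => // i _ di; rewrite dup_high //; have := boxX i; lia.
- have trivial_filter i : 0 < i -> [seq a <- row X i | a <= r] = row X i.
    move=> i0; apply/all_filterP/allP => a ai; rewrite -lX.
    exact: tlength_max ai.
  rewrite !row_truncate // !rowZ // leqnn ltnn /= filter_rcons ltnn.
  by rewrite trivial_filter.
- have row_d := rowZ d d0; rewrite leqnn in row_d.
  split.
    split; last by rewrite /label /= row_d nth_rcons sizeX ltnn eqxx.
    by split=> //=; rewrite rowlen_shape row_d size_rcons sizeX.
  move=> [i y] [[/= i0 /andP[y0]]]; rewrite rowlen_shape /label /= => yi.
  rewrite leqNgt => laby; apply/negP => di.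
  (* Below row d the image consists of rows of X, whose labels are at most r. *)
  have : nth 0 (row (beta d (alpha d X)) i) y.-1 \in row X i.-1.
    have rowi : row (beta d (alpha d X)) i = row X i.-1.
      by rewrite rowZ // [i <= d]leqNgt di.
    by rewrite rowi in yi *; apply: mem_nth; rewrite prednK.
  have i1 : 0 < i.-1 by lia.
  by rewrite laby => /(tlength_max i1); rewrite lX ltnn.
- apply/prime_height_dominant => // j jd.
  rewrite !rowlen_shape !sizeZ //; try lia.
  by rewrite !dup_low //; try lia; have := domX' j jd; lia.
Qed.

(** * Recovering X from Z *)

Lemma mem_row_succ (T : filling) (k i : nat) :
  rowcount T k i < rowcount T k.+1 i -> k.+1 \in row T i.
Proof.
rewrite /rowcount => lt_cnt; apply: contraTT lt_cnt => notin; rewrite -leqNgt.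
apply: eq_leq; apply: eq_in_count => a ai /=; rewrite [LHS]leq_eqVlt ltnS.
by have [eqa|//] := eqVneq a k.+1; rewrite -eqa ai in notin.
Qed.

(** Both sides are strictly increasing with the same elements. *)
Lemma sorted_filter_rcons (s : seq nat) (r : nat) : sorted ltn s ->
  {in s, forall a, a <= r.+1} -> r.+1 \in s ->
  rcons [seq a <- s | a <= r] r.+1 = s.
Proof.
move=> ss ler rs; apply: (irr_sorted_eq ltn_trans ltnn) => //.
  have /= := sorted_filter ltn_trans (fun a => a <= r) ss.
  case E: [seq a <- s | a <= r] => [|b u] //= pu; rewrite rcons_path pu /= ltnS.
  have : last b u \in [seq a <- s | a <= r] by rewrite E mem_last.
  by rewrite mem_filter => /andP[].
move=> a; rewrite mem_rcons inE mem_filter; have [->|ne] //= := eqVneq a r.+1.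
by case: (boolP (a \in s)) => [/ler|]; rewrite ?andbF // andbT; lia.
Qed.

Lemma row_delete (d : nat) (T : filling) (i : nat) : 0 < i ->
  row (take d T ++ drop d.+1 T) i = if i <= d then row T i else row T i.+1.
Proof.
case: i => // i _; rewrite /row /= nth_cat size_take_min.
have [dT|Td] := leqP d (size T).
  by case: ltnP => di; [rewrite nth_take|rewrite nth_drop; congr nth; lia].
case: ltnP => iT; first by rewrite (ltn_trans iT) // nth_take // (ltn_trans iT).
by rewrite nth_drop; case: ifP => _; rewrite !nth_default //; lia.
Qed.

(** The end-box puts row d into the last strip, dominance extends that strip up to row 1, and
    maximality of the end-box stops it at row d. *)
Lemma last_strip (n d r : nat) (Z : filling) : 0 < d -> Zset r d n Z ->
  rowcount Z r d = n - d /\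
  forall i, 0 < i -> rowcount Z r.+1 i = rowcount Z r i + (i <= d).
Proof.
move=> d0 [/psi_tableauE[tZ covZ]
  [lZ _ _ end_d /(prime_height_dominant _ d0) domZ]].
have srt i : 0 < i -> sorted ltn (row Z i).
  by case/tableauE: tZ => _ + _ _; apply.
have [[[[_ /= yd] labd] end_max]] := end_d.
rewrite rowlen_shape in yd; rewrite /label /= in labd.
(* Column n-d+1 is position n-d counted from 0. Its label r+1 makes the count in row d grow from r
   to r+1, so row d is in the strip. *)
have cnt_lo := lt_count_sorted r (n - d) (srt d d0).
have cnt_hi := lt_count_sorted r.+1 (n - d) (srt d d0).
rewrite labd ltnn andbF in cnt_lo; rewrite labd leqnn yd in cnt_hi.
rewrite -!/(rowcount _ _ _) in cnt_lo cnt_hi.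
have [|c [t [tc corner top below eqL]]] := covZ r.+1.
  by rewrite lZ ltnS leqnn.
rewrite /= in eqL.
have tdc : t < d <= c by have := eqL d d0; case: (t < d <= c); lia.
have dcnt : dominant d (rowcount Z r.+1).
  by move=> j jd; rewrite !rowcount_size ?lZ -?rowlen_shape ?domZ //; lia.
have t0 := strip_across_dominant dcnt tdc top below; subst t.
have c0 : 0 < c by lia.
have cd : c <= d.
  have rc : r.+1 \in row Z c.
    by apply: mem_row_succ; rewrite eqL // c0 leqnn; lia.
  apply: (end_max (c, (index r.+1 (row Z c)).+1)); split.
    by split=> //=; rewrite rowlen_shape index_mem.
  by rewrite /label /= nth_index.
have cd' : c = d by lia.
subst c; split; first by have := eqL d d0; lia.
by move=> i i0; rewrite eqL // i0.
Qed.

(** The preimage is Z^(r) with row d+1 deleted; since that row is identical to row d, [alpha d]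
    restores it, and [last_strip] shows that [beta d] restores the label r+1. *)
Lemma Zset_beta_alpha (n d r : nat) (Z : filling) : 0 < d <= n ->
  Zset r d n Z -> exists2 X, Xset r d n X & beta d (alpha d X) = Z.
Proof.
move=> /andP[d0 dn] ZZ; have [cntd cntS] := last_strip d0 ZZ.
have [psiZ [lZ inZ idZ _ /(prime_height_dominant _ d0) domZ]] := ZZ.
have [tZ covZ] := iffLR (psi_tableauE _) psiZ.
have [neZ srtZ decZ labZ] := iffLR (tableauE _) tZ.
have antiZ k := nonincr_le (decZ k).
rewrite !row_truncate // in idZ.
have idZ_count k : k <= r -> rowcount Z k d.+1 = rowcount Z k d.
  have cf i : k <= r ->
      rowcount Z k i = count (fun a => a <= k) [seq a <- row Z i | a <= r].
    move=> kr; rewrite count_filter; apply: eq_count => a /=.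
    by apply/esym/andb_idr => /leq_trans; apply.
  by move=> kr; rewrite !cf // idZ.
have rowZ i : 0 < i -> row Z i =
    if i <= d then rcons [seq a <- row Z i | a <= r] r.+1
    else [seq a <- row Z i | a <= r].
  move=> i0; have := cntS i i0; case: leqP => di eq_cnt.
    rewrite sorted_filter_rcons ?srtZ //.
    - by move=> a ai; rewrite -lZ; apply: tlength_max ai.
    - by apply: mem_row_succ; rewrite eq_cnt addn1.
  apply/esym/all_filterP; rewrite all_count -/(rowcount Z r i).
  rewrite -[rowcount _ _ _]addn0.
  by rewrite -eq_cnt rowcount_size ?lZ.
(* The row of Z from which row i of X is taken. *)
pose src i := if i <= d then i else i.+1.
pose X := take d (truncate r Z) ++ drop d.+1 (truncate r Z).
have rowX i : 0 < i -> row X i = [seq a <- row Z (src i) | a <= r].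
  move=> i0; rewrite row_delete // /src.
  by case: ifP => _; rewrite row_truncate.
have src0 i : 0 < i -> 0 < src i by rewrite /src; case: ifP.
have cntX k i : 0 < i -> rowcount X k i = rowcount Z (minn k r) (src i).
  move=> i0; rewrite /rowcount rowX // count_filter; apply: eq_count => a /=.
  by rewrite leq_min.
have neX : [::] \notin X.
  have ne_trunc : [::] \notin truncate r Z by rewrite mem_filter eqxx.
  rewrite mem_cat negb_or; apply/andP; split; apply: contra ne_trunc.
    exact: mem_take.
  exact: mem_drop.
have labX a : (a \in flatten X) = (1 <= a <= r).
  apply/idP/idP.
    move=> /mem_flatten_row[i i0]; rewrite rowX // mem_filter => /andP[ar ai].
    have : a \in flatten Z.
      by apply/mem_flatten_row; exists (src i); rewrite ?src0.
    by rewrite labZ ar => /andP[->].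
  move=> /andP[a0 ar]; have : a \in flatten Z by rewrite labZ lZ a0 leqW.
  move=> /mem_flatten_row[i i0 ai]; apply/mem_flatten_row.
  have {}ai : a \in [seq a <- row Z i | a <= r] by rewrite mem_filter ar.
  have [id|di] := leqP i d; first by exists i; rewrite // rowX // /src id.
  (* A label of the deleted row is found again in row d. *)
  have [ei|ne] := eqVneq i d.+1.
    by exists d; rewrite // rowX // /src leqnn idZ -ei.
  exists i.-1; first by lia.
  rewrite rowX /src; last by lia.
  by rewrite ifN ?prednK //; lia.
have lX : tlength X = r by apply: tlength_eq.
have tX : is_tableau X.
  apply/tableauE; split=> //; last by rewrite lX.
    move=> i i0; rewrite rowX // sorted_filter ?srtZ ?src0 //.
    exact: ltn_trans.
  move=> k i i0; rewrite !cntX //; apply: antiZ; rewrite src0 //= /src.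
  by do 2!case: ifP; lia.
have dupX k i : k <= r -> 0 < i -> dup d (rowcount X k) i = rowcount Z k i.
  move=> kr i0; have [id|di] := leqP i d.
    by rewrite dup_low // cntX // /src id (minn_idPl kr).
  case: i i0 di => // i _ di; rewrite dup_high // cntX ?(leq_trans d0) //.
  rewrite (minn_idPl kr) /src; have [->|ne] := eqVneq i d.
    by rewrite leqnn idZ_count.
  by rewrite ifN //; lia.
have cntX_low k i : k <= r -> 0 < i <= d -> rowcount X k i = rowcount Z k i.
  by move=> kr /andP[i0 id]; rewrite -dupX // dup_low.
have domX k : k <= r -> dominant d (rowcount X k).
  move=> kr j jd; rewrite !cntX_low //; try lia.
  by apply: (dominant_truncation d0 psiZ domZ) => //; rewrite lZ leqW.
have sizeX i : 0 < i -> size (row X i) = rowcount X r i.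
  by move=> i0; rewrite rowcount_size // lX.
have sizeXd : size (row X d) = n - d by rewrite sizeX // cntX_low // d0 leqnn.
exists X; first split=> //.
- apply/psi_tableauE; split=> // k; rewrite lX => /andP[k0 kr].
  apply: (cov_of_dup d0 (domX k kr)).
  apply: (@eq_cov (rowcount Z k.-1) (rowcount Z k)).
  + by move=> i i0; rewrite dupX //; lia.
  + by move=> i i0; rewrite dupX.
  by apply: covZ; rewrite lZ k0 leqW.
- apply/sub_boxes => i i0.
  rewrite rowlen_shape rowlen_staircase // prednK; last lia.
  (* Rows above d satisfy f(i) < f(d) = n by dominance; rows below d come from row i+1 of Z, where
     the bound of the larger staircase is n - i. *)
  have [id|di] := ltnP i d.
    by have := domX r (leqnn r) i; rewrite -!sizeX // sizeXd i0 id; lia.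
  have [->|ne] := eqVneq i d; first by rewrite sizeXd.
  have /sub_boxes/(_ i.+1 isT) := inZ.
  rewrite rowlen_shape rowlen_staircase // sizeX // cntX // /src ifN; last lia.
  by apply: leq_trans; rewrite minnn count_size.
- apply/prime_height_dominant => // j jd.
  rewrite !rowlen_shape !sizeX //; try lia.
  exact: domX.
apply: row_ext => //; first exact/beta_nonempty/alpha_nonempty.
move=> i i0; rewrite beta_alpha_rows // [RHS]rowZ // lX.
have [id|di] := leqP i d.
  by rewrite rowX // /src id.
case: i i0 di => // i _ di; rewrite rowX /src ?(leq_trans d0) //=.
have [->|ne] := eqVneq i d; first by rewrite leqnn idZ.
by rewrite ifN //; lia.
Qed.

Theorem theorem4p3 (n d r : nat) (hd : 1 <= d) (hdn : d <= n) :
  (forall X : filling,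
     is_tableau X -> tlength X = r -> size (row X d) = n - d ->
     (forall i, 1 <= i <= d ->
        size (row (beta d (alpha d X)) i) = (size (row X i)).+1) /\
     (forall j, 1 <= j <= n - d ->
        collen (beta d (alpha d X)) j = (collen X j).+1)) /\
  set_bij (Xset r d n) (Zset r d n) (fun X => beta d (alpha d X)).
Proof.
split=> [X tX _ sizeX|].
  split=> [i|j jd]; first exact: beta_alpha_sizes.
  by apply: beta_alpha_collen; rewrite ?sizeX.
have dn : 0 < d <= n by rewrite hd.
split=> [X||Z ZZ]; first exact: beta_alpha_Zset.
  move=> X X' /set_mem[[tX _] lX _ _ _] /set_mem[[tX' _] lX' _ _ _].
  have [neX _ _ _] := iffLR (tableauE X) tX.
  have [neX' _ _ _] := iffLR (tableauE X') tX'.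
  by apply: beta_alpha_inj => //; rewrite lX lX'.
by have [X XX eqZ] := Zset_beta_alpha dn ZZ; exists X.
Qed.
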